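(* Let $n\ge 2$ be an integer, let $\alpha=(x_1,\dots,x_n):[0,1]\to[0,1]^n$ be the $n$-dimensional Peano curve defined in the context, and let $i\in\{1,\dots,n\}$. Then the following hold. (i) For all $q>1/n$, the function $x_i$ is nowhere $q$-Hölder continuous, i.e. there is no $t\in[0,1]$ at which $x_i$ is $q$-Hölder continuous. In particular, $x_i$ is nowhere differentiable. (ii) The Hausdorff dimension and the packing dimension of the graph $\{(t,x_i(t)) : t\in[0,1]\}\subset\mathbb{R}^2$ are both equal to $2-1/n$.
   Context: Fix an integer $n\ge 2$; $\mathbb{N}=\{1,2,3,\dots\}$. Let $D=\{0,1,2\}$ and let $\mathcal{S}_D$ be the set of all sequences $\mathbf{t}=(t_k)_{k\in\mathbb{N}}$ with $t_k\in D$. Let $\xi:D\to D$, $\xi(a)=2-a$, and let $\xi^m$ denote its $m$-fold iterate ($\xi^0=\mathrm{id}$). For $1\le i\le n$, $j\ge 0$ and $\mathbf{t}\in\mathcal{S}_D$ put $$S_{i+jn}(\mathbf{t})=\sum_{k=1}^{i+jn}t_k-\sum_{s=0}^{j}t_{i+sn}\quad(\text{a nonnegative integer}),\qquad x_i(\mathbf{t})=\sum_{j=0}^{\infty}\frac{\xi^{S_{i+jn}(\mathbf{t})}(t_{i+jn})}{3^{j+1}}\in[0,1].$$ Let $\Phi:\mathcal{S}_D\to[0,1]$, $\Phi(\mathbf{t})=\sum_{k\ge1}t_k/3^k$. An element $\mathbf{t}\in\Phi^{-1}(t)$ is called a ternary representation of $t\in[0,1]$. The value $x_i(\mathbf{t})$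 is the same for all ternary representations $\mathbf{t}$ of a given $t$, so the function $x_i:[0,1]\to[0,1]$, $x_i(t):=x_i(\mathbf{t})$ for any $\mathbf{t}\in\Phi^{-1}(t)$, is well defined. The map $\alpha=(x_1,\dots,x_n)$ is called the $n$-dimensional Peano curve. A function $f:I\subset\mathbb{R}\to\mathbb{R}$ is called $q$-Hölder continuous at $t\in I$ if there exist $C,\delta>0$ such that $|f(t)-f(t')|\le C|t-t'|^q$ for all $t'\in I$ with $|t-t'|<\delta$. *)

(* Defs.v *)
From mathcomp Require Import all_boot all_order all_algebra.
From mathcomp Require Import all_classical all_reals all_analysis.

Set Implicit Arguments.
Unset Strict Implicit.
Unset Printing Implicit Defensive.

Import Order.TTheory GRing.Theory Num.Theory.
Import numFieldNormedType.Exports.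

Local Open Scope classical_set_scope.
Local Open Scope ring_scope.

(* Digits 0, 1, 2.  Sequences are indexed from 1: the value at index 0 of a
   [ternary_seq] is never used. *)
Definition ternary_seq := nat -> 'I_3.

(* [rev_ord] on ['I_3] is a |-> 2 - a. *)
Definition xi (a : 'I_3) : 'I_3 := rev_ord a.

(* With m = i + j * n, the number S_m; the second sum is part of the first
   one when 1 <= i <= n, so the truncated subtraction is exact. *)
Definition peano_S (n i j : nat) (t : ternary_seq) : nat :=
  (\sum_(1 <= k < (i + j * n).+1) (t k : nat)
     - \sum_(0 <= s < j.+1) (t (i + s * n) : nat))%N.

Section PeanoCurve.
Variable R : realType.

Definition ternary_value (t : ternary_seq) : R :=
  limn (fun N : nat => \sum_(1 <= k < N) (t k)%:R / 3 ^+ k : R).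

Definition peano_seq_coord (n i : nat) (t : ternary_seq) : R :=
  limn (fun N : nat => \sum_(0 <= j < N)
    (iter (peano_S n i j t) xi (t (i + j * n)%N))%:R / 3 ^+ j.+1 : R).

(* The coordinate x_i on [0, 1]: [xget] selects some ternary representation of
   x (the result does not depend on which).  Outside [0, 1], where there is no
   representation, the value is junk. *)
Definition peano_coord (n i : nat) (x : R) : R :=
  peano_seq_coord n i
    (xget (fun=> ord0) [set t : ternary_seq | ternary_value t = x]).

Definition holder_at (I : set R) (f : R -> R) (q t : R) : Prop :=
  exists C delta : R, [/\ 0 < C, 0 < delta &
    forall t', I t' -> `|t - t'| < delta ->
      `|f t - f t'| <= C * `|t - t'| `^ q].

(* One-sided at a point of I that is an endpoint of the interval I. *)
Definition differentiable_in (I : set R) (f : R -> R) (t : R) : Prop :=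
  exists l : R,
    (fun t' => (f t' - f t) / (t' - t)) @ within I t^' --> l.

Definition graph_on (I : set R) (f : R -> R) : set (R * R) :=
  [set (t, f t) | t in I].

End PeanoCurve.

(* The library's metric on R * R is the sup metric; dimensions below are taken
   with respect to the Euclidean one. *)
Section PlaneDimensions.
Variable R : realType.
Local Notation plane := (R * R)%type.

Definition eucl_dist (x y : plane) : R :=
  Num.sqrt ((x.1 - y.1) ^+ 2 + (x.2 - y.2) ^+ 2).

Definition eucl_ball (c : plane) (r : R) : set plane :=
  [set x | eucl_dist c x <= r].

Local Open Scope ereal_scope.

(* -oo on the empty set. *)
Definition diam (U : set plane) : \bar R :=
  ereal_sup [set (eucl_dist x y)%:E | x in U & y in U].

(* |U|^s, with the conventions |set0|^s = 0 for all s >= 0, and 0^0 = 1. *)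
Definition diam_pow (s : R) (U : set plane) : \bar R :=
  if U == set0 then 0 else poweR (diam U) s.

(* Finite covers are included: the sets U k may be empty. *)
Definition delta_cover (delta : R) (A : set plane) : set (nat -> set plane) :=
  [set U | A `<=` \bigcup_k U k /\ forall k, diam (U k) <= delta%:E].

Definition hausdorff_premeasure (s delta : R) (A : set plane) : \bar R :=
  ereal_inf [set \sum_(0 <= k <oo) diam_pow s (U k) | U in delta_cover delta A].

(* The supremum is the limit as delta tends to 0, by monotonicity. *)
Definition hausdorff_measure (s : R) (A : set plane) : \bar R :=
  ereal_sup [set hausdorff_premeasure s delta A | delta in [set d : R | (0 < d)%R]].

Definition hausdorff_dim (A : set plane) : \bar R :=
  ereal_inf [set s%:E | s in [set s : R | (0 <= s)%R /\ hausdorff_measure s A = 0]].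

(* Countable (finite or infinite) families, indexed by I, of pairwise disjoint
   closed balls centred in A with radii at most delta. *)
Definition delta_packing (delta : R) (A : set plane)
    (I : set nat) (c : nat -> plane) (r : nat -> R) : Prop :=
  (forall k, I k -> A (c k) /\ (0 < r k <= delta)%R) /\
  trivIset I (fun k => eucl_ball (c k) (r k)).

Definition packing_prepremeasure (s delta : R) (A : set plane) : \bar R :=
  ereal_sup [set e | exists (I : set nat) (c : nat -> plane) (r : nat -> R),
    delta_packing delta A I c r /\
    e = \esum_(k in I) diam_pow s (eucl_ball (c k) (r k))].

(* The infimum is the limit as delta tends to 0, by monotonicity. *)
Definition packing_premeasure (s : R) (A : set plane) : \bar R :=
  ereal_inf [set packing_prepremeasure s delta A | delta in [set d : R | (0 < d)%R]].

Definition packing_measure (s : R) (A : set plane) : \bar R :=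
  ereal_inf [set \sum_(0 <= k <oo) packing_premeasure s (F k) |
    F in [set F : nat -> set plane | A `<=` \bigcup_k F k]].

Definition packing_dim (A : set plane) : \bar R :=
  ereal_inf [set s%:E | s in [set s : R | (0 <= s)%R /\ packing_measure s A = 0]].

End PlaneDimensions.

(* Main.v *)
(* Reading a point of [0, 1] through a chosen ternary representation, its first
   n * k digits determine the first k digits of f = x_i.

   (i) Every value of the next digit of f can be realised by a point y with the
   same first n * k digits as x, so f oscillates by about 3^-k at distance at
   most 3^-(n k) from x.  Choosing y in the middle of a triadic interval fixes
   the relevant digits of all its representations, so that the coordinate being
   well defined is never needed.

   (ii) Cut the unit square into cells of side 3^-(n k).  A column of width
   3^-(n k) meets the graph in at most 3^((n-1) k) cells, which bounds both
   dimensions by d = 2 - 1/n.  Conversely, xi being a bijection, the digits of f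
   behind the first k are independent and uniform under Lebesgue measure given
   the first n * k digits of the point, so that the set of x with (x, f x) in a
   given cell has outer measure at most (3^-(n k))^d.  The mass distribution
   principle then bounds the Hausdorff measure from below; for packings, one
   centres balls in alternate cells meeting the given set. *)
Require Import Defs.
From mathcomp Require Import all_boot all_order all_algebra.
From mathcomp Require Import all_classical all_reals all_analysis.
From mathcomp Require Import zify ring lra.

Set Implicit Arguments.
Unset Strict Implicit.
Unset Printing Implicit Defensive.

Import Order.TTheory GRing.Theory Num.Theory.
Import numFieldNormedType.Exports.
Local Open Scope classical_set_scope.
Local Open Scope ring_scope.

(** * Ternary digits *)

(** The most significant digit comes first, so that dropping final digits is integer division and
    dividing by [3 ^ N] gives a partial sum of the expansion. *)
Fixpoint digit_prefix (u : nat -> 'I_3) (N : nat) : nat :=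
  if N is N'.+1 then (3 * digit_prefix u N' + u N')%N else 0%N.

Lemma digit_prefix_lt u N : (digit_prefix u N < 3 ^ N)%N.
Proof. elim: N => //= N IH; rewrite expnS; have := ltn_ord (u N); lia. Qed.

Lemma digit_prefix_inj u v N : digit_prefix u N = digit_prefix v N ->
  forall j, (j < N)%N -> u j = v j.
Proof.
elim: N => //= N IH e.
have lu := ltn_ord (u N); have lv := ltn_ord (v N).
have [ep ed] : digit_prefix u N = digit_prefix v N /\ u N = v N :> nat by lia.
move=> j; rewrite ltnS leq_eqVlt => /orP[/eqP ->|/(IH ep)//].
exact: val_inj.
Qed.

Lemma eq_digit_prefix u v N : (forall j, (j < N)%N -> u j = v j) ->
  digit_prefix u N = digit_prefix v N.
Proof.
elim: N => //= N IH e; rewrite e// IH// => j jN.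
by apply: e; rewrite ltnS ltnW.
Qed.

Lemma digit_prefix_div u N M :
  (digit_prefix u (N + M) %/ 3 ^ M)%N = digit_prefix u N.
Proof.
elim: M => [|M IH]; first by rewrite addn0 expn0 divn1.
rewrite addnS /= expnS divnMA mulnC divnMDl// (divn_small (ltn_ord _)) addn0.
exact: IH.
Qed.

Section DigitValue.
Variable R : realType.
Implicit Type u : nat -> 'I_3.

Definition digit_value u : R :=
  limn (fun N : nat => \sum_(0 <= j < N) (u j)%:R / 3 ^+ j.+1 : R).

Lemma expr3_gt0 N : 0 < 3 ^+ N :> R.
Proof. by rewrite exprn_gt0. Qed.

Lemma digit_sumE u N :
  \sum_(0 <= j < N) (u j)%:R / 3 ^+ j.+1 = (digit_prefix u N)%:R / 3 ^+ N :> R.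
Proof.
elim: N => [|N IH]; first by rewrite big_nil mul0r.
rewrite big_nat_recr//= IH natrD natrM exprS.
by field; rewrite expf_neq0.
Qed.

(** By the Archimedean property a positive [y] would have unbounded multiples. This turns estimates
    valid at all triadic scales into equalities. *)
Lemma expr3_bounded_le0 (y C : R) : (forall N, 3 ^+ N * y <= C) -> y <= 0.
Proof.
move=> H; rewrite leNgt; apply/negP => y0.
have C0 : 0 <= C by apply: le_trans (H 0%N); rewrite mul1r ltW.
have := archi_boundP (divr_ge0 C0 (ltW y0)).
rewrite ltr_pdivrMr//; set N := Num.bound _ => lN.
have := H N; apply/negP; rewrite -ltNge (lt_le_trans lN)// ler_wpM2r ?(ltW y0)//.
by rewrite -natrX ler_nat ltnW// ltn_expl.
Qed.

Lemma digit_sum_nd u :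
  {homo (fun N => \sum_(0 <= j < N) (u j)%:R / 3 ^+ j.+1 : R)
    : N M / (N <= M)%N >-> N <= M}.
Proof.
apply/nondecreasing_seqP => N; rewrite big_nat_recr//= lerDl.
by rewrite divr_ge0// exprn_ge0.
Qed.

Lemma digit_sum_le u N M : (N <= M)%N ->
  (digit_prefix u M)%:R / 3 ^+ M <= ((digit_prefix u N)%:R + 1) / 3 ^+ N :> R.
Proof.
move=> /subnKC <-; move: (M - N)%N => {}M.
rewrite exprD invfM mulrA ler_pdivrMr ?expr3_gt0//.
rewrite mulrAC ler_pM2r ?invr_gt0 ?expr3_gt0//.
rewrite natr1 -natrX -natrM ler_nat -(digit_prefix_div u N M).
by rewrite ltnW// -ltn_divLR// ?expn_gt0.
Qed.

Lemma is_cvg_digit_sum u :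
  cvgn (fun N => \sum_(0 <= j < N) (u j)%:R / 3 ^+ j.+1 : R).
Proof.
apply: nondecreasing_is_cvgn; first exact: (@digit_sum_nd u).
exists 1 => _ [N _ <-]; rewrite digit_sumE.
by have := digit_sum_le u (leq0n N); rewrite /= add0r divr1.
Qed.

(** The interval is closed on the right because the upper bound is attained when all digits from
    index [N] on are 2. *)
Lemma digit_value_itv u N :
  (digit_prefix u N)%:R <= 3 ^+ N * digit_value u <= (digit_prefix u N)%:R + 1.
Proof.
apply/andP; split.
  rewrite mulrC -ler_pdivrMr ?expr3_gt0// -digit_sumE.
  exact: (nondecreasing_cvgn_le (@digit_sum_nd u) (@is_cvg_digit_sum u) N).
rewrite mulrC -ler_pdivlMr ?expr3_gt0//.
apply: limr_le; first exact: is_cvg_digit_sum.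
near=> M; rewrite digit_sumE; apply: digit_sum_le.
by near: M; exists N.
Unshelve. all: end_near. Qed.

Lemma digit_value_eq u (x : R) :
  (forall N, (digit_prefix u N)%:R <= 3 ^+ N * x <= (digit_prefix u N)%:R + 1) ->
  digit_value u = x.
Proof.
move=> H; apply/eqP; rewrite -subr_eq0 -normr_le0.
apply: (@expr3_bounded_le0 _ 1) => N.
rewrite -[3 ^+ N]gtr0_norm ?expr3_gt0// -normrM ler_norml mulrBr.
have := H N; have := digit_value_itv u N; lra.
Qed.

Definition ternary_digit (r : R) : 'I_3 :=
  inord (if 3 * r <= 1 then 0 else if 3 * r <= 2 then 1 else 2).

Definition ternary_rest (r : R) : R := 3 * r - (ternary_digit r)%:R.

Lemma ternary_rest_itv r : 0 <= r <= 1 -> 0 <= ternary_rest r <= 1.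
Proof.
rewrite /ternary_rest /ternary_digit => H.
by case: ifP => h1; [|case: ifP => h2]; rewrite inordK//; lra.
Qed.

Lemma digit_value_surj (x : R) : 0 <= x <= 1 -> exists u, digit_value u = x.
Proof.
move=> x01; pose rest N := iter N ternary_rest x.
exists (fun N => ternary_digit (rest N)); apply: digit_value_eq => N.
have r01 : 0 <= rest N <= 1.
  by elim: N => //= N IH; exact: ternary_rest_itv.
suff : 3 ^+ N * x = (digit_prefix (fun N => ternary_digit (rest N)) N)%:R + rest N.
  by move=> ->; lra.
elim: N {r01} => [|N IH]; first by rewrite /= mul1r add0r.
rewrite exprS -mulrA IH /= natrD natrM /ternary_rest; ring.
Qed.

Lemma ternary_valueE (t : ternary_seq) :
  ternary_value R t = digit_value (fun k => t k.+1).
Proof.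
apply: cvg_lim => //; rewrite -cvg_shiftS /=.
under eq_fun do rewrite big_add1 /=.
exact: is_cvg_digit_sum.
Qed.

End DigitValue.

(** * Digits of the Peano coordinates *)

Lemma iter_xiK m : involutive (iter m xi).
Proof.
elim: m => // m IH a; rewrite iterSr iterS /xi rev_ordK; exact: IH.
Qed.

Definition peano_digit (n i : nat) (t : ternary_seq) (j : nat) : 'I_3 :=
  iter (peano_S n i j t) xi (t (i + j * n)%N).

(** The digit at position [i + j * n] is the last term of both sums and cancels, so only strictly
    earlier digits matter. Hence digit [j] of x_i is a bijective function of that digit once the
    earlier ones are fixed. *)
Lemma eq_peano_S n i j (t t' : ternary_seq) : (0 < i <= n)%N ->
  (forall m, (0 < m < i + j * n)%N -> t m = t' m) ->
  peano_S n i j t = peano_S n i j t'.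
Proof.
move=> /andP[i0 lein] e; have n0 := leq_trans i0 lein.
rewrite /peano_S !(@big_nat_recr _ _ _ (i + j * n)%N 1) ?(leq_trans i0) ?leq_addr//=.
rewrite !(@big_nat_recr _ _ _ j 0)//= !subnDr.
congr (_ - _)%N; apply: eq_big_nat => m; first by move=> ?; rewrite e.
move=> /andP[_ mj]; rewrite e// ltn_add2l ltn_pmul2r//.
by rewrite mj addn_gt0 i0.
Qed.

Lemma eq_peano_digit n i j (t t' : ternary_seq) : (0 < i <= n)%N ->
  (forall m, (0 < m <= i + j * n)%N -> t m = t' m) ->
  peano_digit n i t j = peano_digit n i t' j.
Proof.
move=> hi e; rewrite /peano_digit (@eq_peano_S _ _ _ _ t')//; last first.
  by move=> m /andP[m0 /ltnW mj]; rewrite e// m0.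
by rewrite e// leqnn addn_gt0; case/andP: hi => ->.
Qed.

Lemma leq_peano_pos n i j k : (i <= n)%N -> (j < k)%N -> (i + j * n <= n * k)%N.
Proof. by move=> lein jk; nia. Qed.

Section PeanoCoord.
Variables (R : realType) (n i : nat).
Hypothesis hi : (0 < i <= n)%N.

(** This is the very selection made in [peano_coord], so that [f x] is by conversion the value of
    the digits [peano_digit n i (ternary_rep x)]. *)
Definition ternary_rep (x : R) : ternary_seq :=
  xget (fun=> ord0) [set t : ternary_seq | ternary_value R t = x].

(* The triadic intervals of length 3^-N containing x and f x are
   [W/3^N, (W+1)/3^N] and [Y/3^N, (Y+1)/3^N]. *)
Definition abscissa_prefix N (x : R) := digit_prefix (fun m => ternary_rep x m.+1) N.
Definition ordinate_prefix N (x : R) := digit_prefix (peano_digit n i (ternary_rep x)) N.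

Local Notation W := abscissa_prefix.
Local Notation Y := ordinate_prefix.
Local Notation f := (@peano_coord R n i).

Lemma ternary_repK x : 0 <= x <= 1 -> digit_value R (fun m => ternary_rep x m.+1) = x.
Proof.
move=> /digit_value_surj[u ux]; rewrite -ternary_valueE /ternary_rep.
case: xgetP => [t _ //|H].
by have := H (fun m => u m.-1); rewrite /= ternary_valueE.
Qed.

Lemma abscissa_itv N x : 0 <= x <= 1 ->
  (W N x)%:R <= 3 ^+ N * x <= (W N x)%:R + 1.
Proof. by move=> /ternary_repK {2 3}<-; exact: digit_value_itv. Qed.

Lemma ordinate_itv N x : (Y N x)%:R <= 3 ^+ N * f x <= (Y N x)%:R + 1.
Proof. exact: digit_value_itv. Qed.

Lemma abscissa_dist N x y : 0 <= x <= 1 -> 0 <= y <= 1 -> W N x = W N y ->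
  `|x - y| <= 3 ^- N.
Proof.
move=> x01 y01 e; rewrite -[leRHS]mul1r ler_pdivlMr ?expr3_gt0//.
rewrite -[3 ^+ _]gtr0_norm ?expr3_gt0// -normrM ler_norml mulrBl ![_ * 3 ^+ _]mulrC.
have := abscissa_itv N y01; have := abscissa_itv N x01; rewrite e; lra.
Qed.

Lemma ordinate_dist N x y : Y N x = Y N y -> `|f x - f y| <= 3 ^- N.
Proof.
move=> e; rewrite -[leRHS]mul1r ler_pdivlMr ?expr3_gt0//.
rewrite -[3 ^+ _]gtr0_norm ?expr3_gt0// -normrM ler_norml mulrBl ![_ * 3 ^+ _]mulrC.
have := ordinate_itv N y; have := ordinate_itv N x; rewrite e; lra.
Qed.

Lemma abscissa_prefix_inj N x y : W N x = W N y ->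
  forall m, (0 < m <= N)%N -> ternary_rep x m = ternary_rep y m.
Proof. by move=> e [//|m] /andP[_ mN]; exact: (digit_prefix_inj e). Qed.

Lemma eq_ordinate_prefix k x y :
  W (n * k) x = W (n * k) y -> Y k x = Y k y.
Proof.
move=> e; apply: eq_digit_prefix => j jk; apply: eq_peano_digit => // m /andP[m0 mj].
apply: (abscissa_prefix_inj e); rewrite m0 (leq_trans mj)// leq_peano_pos//.
by case/andP: hi.
Qed.

(** Triadic intervals of level [N] overlap only at endpoints, so a midpoint has the same prefix in
    whichever representation is selected. *)
Lemma abscissa_prefix_mid N (u : nat -> 'I_3) (x : R) :
  3 ^+ N * x = (digit_prefix u N)%:R + 2^-1 ->
  0 <= x <= 1 /\ W N x = digit_prefix u N.
Proof.
move=> e.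
have x01 : 0 <= x <= 1.
  rewrite -(pmulr_rge0 _ (expr3_gt0 R N)) -[x <= 1](ler_pM2l (expr3_gt0 R N)) e mulr1.
  have := digit_prefix_lt u N; rewrite -(ler_nat R) -natr1 natrX.
  have : 0 <= (digit_prefix u N)%:R :> R by [].
  lra.
split=> //; have := abscissa_itv N x01; rewrite e => H.
apply/eqP; rewrite eqn_leq -[(W N x <= _)%N]ltnS -[(_ <= W N x)%N]ltnS.
by rewrite -!(ltr_nat R) -!natr1; lra.
Qed.

Lemma peano_next_digit k x (e : 'I_3) : exists y,
  [/\ 0 <= y <= 1, W (n * k) y = W (n * k) x & Y k.+1 y = (3 * Y k x + e)%N].
Proof.
(* Indices are shifted: [z d m] is the digit at position [m.+1]. It copies [x] up to position
   [n * k] and puts [d] at the position that decides digit [k] of x_i. *)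
pose z d m := if (m < n * k)%N then ternary_rep x m.+1 else
  if m.+1 == (i + k * n)%N then d else ord0.
(* The placeholder [ord0] breaks the circularity: [S] does not depend on the digit at position
   [i + k * n]. As an iterate of [xi] is its own inverse, [d] then yields the digit [e]. *)
pose S := peano_S n i k (fun m => z ord0 m.-1).
pose d := iter S xi e.
pose N := (n * k.+1)%N.
pose y := ((digit_prefix (z d) N)%:R + 2^-1) / 3 ^+ N : R.
have [i0 lein] := andP hi.
have leN : (n * k <= N)%N by rewrite leq_mul2l leqnSn orbT.
have [y01 Wy] : 0 <= y <= 1 /\ W N y = digit_prefix (z d) N.
  by apply: abscissa_prefix_mid; rewrite /y mulrC divfK// expf_neq0.
have rep_y m : (0 < m <= N)%N -> ternary_rep y m = z d m.-1.
  by case: m => // m /andP[_ mN]; exact: (digit_prefix_inj Wy).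
have Wxy : W (n * k) y = W (n * k) x.
  by apply: eq_digit_prefix => m mk; rewrite rep_y /z /= ?mk// (leq_trans mk).
exists y; split=> //; rewrite /Y /=; congr (3 * _ + _)%N.
  exact: eq_ordinate_prefix.
rewrite /peano_digit rep_y; last by rewrite addn_gt0 i0 leq_peano_pos.
rewrite (_ : peano_S _ _ _ _ = S); last first.
  apply: eq_peano_S => // m /andP[m0 mi].
  rewrite rep_y; last by rewrite m0 ltnW// (leq_trans mi)// leq_peano_pos.
  by rewrite /z prednK// (ltn_eqF mi).
rewrite /z prednK ?addn_gt0 ?i0// eqxx ifF /d ?iter_xiK//.
by apply/negbTE; rewrite -ltnNge mulnC -[ltnLHS]add0n ltn_add2r.
Qed.

End PeanoCoord.

(** * Failure of Hölder continuity and of differentiability *)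

Section Holder.
Variables (R : realType) (n i : nat).
Hypotheses (hn : (1 < n)%N) (hi : (0 < i <= n)%N).
Local Notation f := (@peano_coord R n i).

Lemma powR_expr3_lt (e c : R) : 0 < e -> 0 < c ->
  exists N, forall k, (N <= k)%N -> (3 ^- k) `^ e < c.
Proof.
move=> e0 c0; pose x := c `^ e^-1.
have x0 : 0 < x by rewrite powR_gt0.
have [N xN] : exists N, 1 < 3 ^+ N * x.
  apply: contrapT => /forallNP H.
  suff : x <= 0 by rewrite leNgt x0.
  by apply: (@expr3_bounded_le0 _ _ 1) => N; rewrite leNgt; apply/negP/H.
exists N => k Nk; have -> : c = x `^ e by rewrite /x -powRrM mulVf ?gt_eqF// powRr1// ltW.
apply: gt0_ltr_powR; rewrite ?nnegrE ?(ltW x0) ?invr_ge0 ?exprn_ge0//.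
rewrite invf_plt ?posrE ?expr3_gt0//.
apply: lt_le_trans (_ : 3 ^+ N <= _); last by rewrite ler_weXn2l// ler1n.
by rewrite -(ltr_pM2r x0) mulVf ?gt_eqF.
Qed.

(** Realising the next digits 0 and 2 gives two values separated by the interval of digit 1, hence
    [3 ^- k.+1] apart; one of them is at least half of that away from [f x]. *)
Lemma peano_coord_osc k (x : R) : 0 <= x <= 1 ->
  exists y, [/\ 0 <= y <= 1, `|x - y| <= 3 ^- (n * k) &
    3 ^- k.+1 / 2 <= `|f x - f y|].
Proof.
move=> x01.
have [y0 [y001 Wy0 Yy0]] := peano_next_digit hi k x ord0.
have [y2 [y201 Wy2 Yy2]] := peano_next_digit hi k x ord_max.
have [h|h] := leP (3 ^- k.+1 / 2) `|f x - f y0|.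
  by exists y0; split=> //; exact: abscissa_dist.
exists y2; split=> //; first exact: abscissa_dist.
have gap : 3 ^- k.+1 <= `|f y0 - f y2|.
  rewrite -[leLHS]mul1r ler_pdivrMr ?expr3_gt0//.
  rewrite -[3 ^+ _]gtr0_norm ?expr3_gt0// -normrM.
  rewrite -normrN -mulNr opprB.
  have := ordinate_itv n i k.+1 y0; have := ordinate_itv n i k.+1 y2.
  rewrite Yy0 Yy2 /= !natrD mulrBl ![_ * 3 ^+ _]mulrC => H2 H0.
  apply: le_trans (ler_norm _); lra.
have := ler_distD (f x) (f y0) (f y2); rewrite [`|f y0 - f x|]distrC; lra.
Qed.

Lemma peano_not_holder (q x : R) : n%:R^-1 < q -> 0 <= x <= 1 ->
  ~ holder_at `[0, 1]%classic f q x.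
Proof.
move=> hq x01 [C [delta [C0 d0 H]]].
have n0 : 0 < n%:R :> R by rewrite ltr0n; case: n hn.
have q0 : 0 < q by apply: lt_trans hq; rewrite invr_gt0.
have e0 : 0 < n%:R * q - 1.
  by rewrite subr_gt0 -(ltr_pM2l n0) mulfV ?gt_eqF in hq *.
have [N1 hN1] := powR_expr3_lt (@ltr01 R) d0.
(* With this constant the Hölder bound drops below [3 ^- k / 6], which is the oscillation
   [3 ^- k.+1 / 2]. *)
have c0 : 0 < (C * 6)^-1 by rewrite invr_gt0 mulr_gt0.
have [N2 hN2] := powR_expr3_lt e0 c0.
pose k := maxn N1 N2.
have [y [y01 xy fxy]] := peano_coord_osc k x01.
have pos3 m : 0 < 3 ^- m :> R by rewrite invr_gt0 expr3_gt0.
have xyd : `|x - y| < delta.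
  apply: le_lt_trans xy _; have := hN1 (n * k)%N.
  rewrite powRr1 ?(ltW (pos3 _))//; apply.
  by rewrite (leq_trans (leq_maxl _ N2))// leq_pmull// ltnW.
have /= := H y; rewrite in_itv /= => /(_ y01 xyd) Hy.
have hk := hN2 k (leq_maxr _ _).
have : C * `|x - y| `^ q <= C * (3 ^- (n * k)) `^ q.
  rewrite ler_pM2l//; apply: ge0_ler_powR; rewrite ?nnegrE ?(ltW q0) ?(ltW (pos3 _))//.
have -> : (3 ^- (n * k)) `^ q = 3 ^- k * (3 ^- k) `^ (n%:R * q - 1) :> R.
  rewrite mulr_powRB1 ?(ltW (pos3 _)) ?mulr_gt0// powRrM powR_mulrn ?(ltW (pos3 _))//.
  by rewrite exprVn -exprM mulnC.
have : C * (3 ^- k * (3 ^- k) `^ (n%:R * q - 1)) < 3 ^- k / 6.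
  rewrite mulrCA ltr_pM2l// mulrC -ltr_pdivlMr//.
  by rewrite -invfM [6 * C]mulrC.
have : 3 ^- k.+1 = 3 ^- k / 3 :> R by rewrite exprS invfM mulrC.
lra.
Qed.

(** Near [x] the difference quotient stays within 1 of its limit [l], whence the Lipschitz constant
    [|l| + 1]. *)
Lemma differentiable_holder1 (g : R -> R) (x : R) :
  differentiable_in `[0, 1]%classic g x -> holder_at `[0, 1]%classic g 1 x.
Proof.
move=> [l /cvgrPdist_lt /(_ 1 ltr01)].
rewrite /within /= /dnbhs /within /= => /nbhs_ballP[d /= d0 hd].
exists (`|l| + 1), d; split=> //.
move=> y y01 xy; rewrite powRr1//.
have [->|yx] := eqVneq y x; first by rewrite !subrr !normr0 mulr0.
have /= := hd y xy yx y01; set r := (X in `|l - X|) => lr.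
have -> : g x - g y = r * (x - y).
  by rewrite /r; field; rewrite subr_eq0.
rewrite normrM ler_wpM2r//.
have := ler_distD l r 0; rewrite !subr0 [`|r - l|]distrC; lra.
Qed.

End Holder.

(** * Measure of the cells *)

Section CellMeasure.
Variables (R : realType) (n i : nat).
Hypothesis hi : (0 < i <= n)%N.

Local Notation f := (@peano_coord R n i).
Local Notation rep := (@ternary_rep R).
Local Notation W := (@abscissa_prefix R).
Local Notation Y := (@ordinate_prefix R n i).

(** [lebesgue_measure] is applied to arbitrary sets, as an outer measure: monotonicity and
    subadditivity suffice, and measurability of [f] never comes up. *)
Lemma le_lebesgue_outer (A B : set R) : A `<=` B ->
  (lebesgue_measure A <= lebesgue_measure B)%E.
Proof. exact: (le_outer_measure (@lebesgue_measure R)). Qed.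

Lemma lebesgue_outer_bigcup (A : set R) (F : nat -> set R) :
  A `<=` \bigcup_k F k ->
  (lebesgue_measure A <= \sum_(0 <= k <oo) lebesgue_measure (F k))%E.
Proof.
move=> /le_lebesgue_outer/le_trans; apply.
exact: (outer_measure_sigma_subadditive (@lebesgue_measure R)).
Qed.

Lemma lebesgue_outer_bigcup_ord (A : set R) (N : nat) (F : nat -> set R) :
  (forall x, A x -> exists2 k, (k < N)%N & F k x) ->
  (lebesgue_measure A <= \sum_(k < N) lebesgue_measure (F k))%E.
Proof.
move=> AF.
apply: le_trans (outer_measure_subadditive (@lebesgue_measure R) F N).
apply: le_lebesgue_outer => x /AF[k kN Fkx].
by rewrite -bigcup_mkord; exists k.
Qed.

Definition digit_cell (t : ternary_seq) (p : nat) (u : nat -> 'I_3) (m : nat) : set R :=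
  [set x | [/\ 0 <= x <= 1, forall k, (0 < k <= p)%N -> rep x k = t k &
    forall j, (j < m)%N -> peano_digit n i (rep x) j = u j]].

Lemma lebesgue_digit_cell_le (p : nat) (t : ternary_seq) (u : nat -> 'I_3) m :
  (lebesgue_measure (digit_cell t p u m) <= (3 ^- p)%:E)%E.
Proof.
set a := digit_prefix (fun k => t k.+1) p.
apply: (@le_trans _ _ (lebesgue_measure `[a%:R / 3 ^+ p, (a%:R + 1) / 3 ^+ p : R]%classic)).
  apply: le_lebesgue_outer => x [x01 xt _]; rewrite /= in_itv /=.
  rewrite ler_pdivrMr ?ler_pdivlMr ?expr3_gt0// mulrC.
  have -> : a = W p x by apply: eq_digit_prefix => j jp; rewrite xt.
  exact: abscissa_itv.
rewrite lebesgue_measure_itv /= lte_fin ltr_pM2r ?invr_gt0 ?expr3_gt0//.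
by rewrite ltrDl ltr01 -EFinB -mulrBl addrAC subrr add0r mul1r lexx.
Qed.

Definition set_digit (t : ternary_seq) (p : nat) (d : 'I_3) : ternary_seq :=
  fun k => if k == p then d else t k.

Lemma digit_cellS t p u m x (d : 'I_3) : digit_cell t p u m x ->
  rep x p.+1 = d -> digit_cell (set_digit t p.+1 d) p.+1 u m x.
Proof.
move=> [x01 xt xu] xd; split=> // k /andP[k0 kp]; rewrite /set_digit.
case: eqP => [->//|/eqP kp1]; apply: xt.
by rewrite k0 -ltnS ltn_neqAle kp1.
Qed.

(* Every digit position beyond p divides the outer measure by 3; the positions
   congruent to i modulo n do so twice over, since there the digit of t is
   forced by the prescribed digit of x_i and the preceding digits of t. *)
Lemma lebesgue_digit_cell q m p (t : ternary_seq) (u : nat -> 'I_3) :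
  (p + q = n * m)%N ->
  (lebesgue_measure (digit_cell t p u m)
     <= (3 ^- (p + \sum_(j < m) (p < i + j * n)))%:E)%E.
Proof.
have [i0 lein] := andP hi.
elim: q p t => [|q IH] p t pq.
  rewrite big1 ?addn0; first exact: lebesgue_digit_cell_le.
  move=> j _; rewrite ltnNge (leq_trans (leq_peano_pos lein (ltn_ord j)))//.
  by rewrite -pq addn0.
rewrite addnS -addSn in pq.
have [[j0 j0p]|nj] := pselect (exists j : 'I_m, p.+1 = (i + j * n)%N).
  (* The only digit at position [p.+1] compatible with the prescribed digit [j0] of x_i. *)
  pose d := iter (peano_S n i j0 t) xi (u j0).
  apply: (@le_trans _ _ (lebesgue_measure (digit_cell (set_digit t p.+1 d) p.+1 u m))).
    apply: le_lebesgue_outer => x xp; apply: digit_cellS => //.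
    case: xp => [x01 xt xu].
    have := xu j0 (ltn_ord j0); rewrite /peano_digit /d => <-.
    rewrite (@eq_peano_S _ _ _ t (rep x)) ?iter_xiK ?j0p//.
    by move=> k /andP[k0]; rewrite -j0p ltnS => kp; rewrite xt// k0.
  apply: le_trans (IH _ _ pq) _; rewrite lee_fin.
  (* Exactly the summand [j0] drops out, which offsets the growth of [p] by one and leaves the bound
     unchanged. *)
  have -> : (\sum_(j < m) (p < i + j * n) = (\sum_(j < m) (p.+1 < i + j * n)).+1)%N.
    rewrite (bigD1 j0)//= [in RHS](bigD1 j0)//= -j0p ltnn ltnSn -addnS add1n.
    congr S; apply: eq_bigr => j jj0; rewrite [in RHS]ltn_neqAle j0p eqn_add2l.
    rewrite eqn_pmul2r ?(leq_trans i0)// [_ == _ :> nat]eq_sym.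
    by rewrite -[(j : nat) == _]/(j == j0) jj0 -j0p.
  by rewrite addnS addSn.
have -> : (\sum_(j < m) (p < i + j * n) = \sum_(j < m) (p.+1 < i + j * n))%N.
  apply: eq_bigr => j _; rewrite [in RHS]ltn_neqAle.
  by case: eqP => //= e; case: nj; exists j.
set Q := (\sum_(j < m) _)%N in IH *.
(* At an unconstrained position the three possible digits contribute a third of the bound each. *)
apply: (@le_trans _ _ (\sum_(d < 3) (3 ^- (p.+1 + Q))%:E)%E).
  pose F d := digit_cell (set_digit t p.+1 (inord d)) p.+1 u m.
  apply: le_trans (_ : \sum_(d < 3) lebesgue_measure (F d) <= _)%E.
    apply: lebesgue_outer_bigcup_ord => x xp.
    by exists (rep x p.+1) => //; apply: digit_cellS => //; rewrite inord_val.
  by apply: lee_sum => d _; exact: IH.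
rewrite sumEFin lee_fin sumr_const card_ord addSn exprS invfM.
by rewrite -[leLHS]mulr_natl mulrA divff// mul1r.
Qed.

Definition cell k (a b : nat) : set R :=
  [set x | [/\ 0 <= x <= 1, W (n * k) x = a & Y (n * k) x = b]].

(** This is [n * k] times the dimension 2 - 1/n: all [n * k] digits of the abscissa, and the digits
    of [f] that these do not determine. *)
Definition cell_exp k : nat := (n * k + (n * k - k))%N.

Lemma lebesgue_cell k a b :
  (lebesgue_measure (cell k a b) <= (3 ^- cell_exp k)%:E)%E.
Proof.
have [i0 lein] := andP hi.
have [[x0 [x001 x0a x0b]]|ne] := pselect (exists x, cell k a b x); last first.
  have -> : cell k a b = set0 by apply/seteqP; split=> // x cx; case: ne; exists x.
  by rewrite measure0 lee_fin invr_ge0 ltW// expr3_gt0.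
pose t := rep x0; pose u := peano_digit n i (rep x0).
apply: (@le_trans _ _ (lebesgue_measure (digit_cell t (n * k) u (n * k)))).
  apply: le_lebesgue_outer => x [x01 xa xb]; split=> //.
    by apply: abscissa_prefix_inj; rewrite xa.
  by apply: digit_prefix_inj; rewrite -/(Y _ _) xb -x0b.
have kn : (k <= n * k)%N by rewrite leq_pmull// (leq_trans i0).
apply: le_trans (@lebesgue_digit_cell (n * (n * k) - n * k) _ _ _ _ _) _.
  by rewrite subnKC// leq_pmull// (leq_trans i0).
rewrite lee_fin lef_pV2 ?posrE ?expr3_gt0// ler_weXn2l ?ler1n// leq_add2l.
(* Digits of x_i with index at least [k] sit at positions beyond [n * k]; each adds one to the
   exponent. *)
rewrite -(big_mkord xpredT (fun j => (n * k < i + j * n)%N : nat)).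
rewrite (@big_cat_nat _ _ _ k)//= -[leqLHS]add0n leq_add//.
rewrite (@eq_big_nat _ _ _ _ _ _ (fun=> 1%N)) ?sum_nat_const_nat ?muln1// => j /andP[kj _].
by rewrite [(n * k)%N]mulnC -[(k * n)%N]add0n -addSn leq_add// leq_mul2r kj orbT.
Qed.

End CellMeasure.

(** * Plane geometry and numbering of the cells *)

Section PlaneGeometry.
Variable R : realType.
Implicit Types (x y : R * R) (U V : set (R * R)) (r s : R).

Lemma eucl_dist_le x y r : `|x.1 - y.1| <= r -> `|x.2 - y.2| <= r ->
  eucl_dist x y <= 2 * r.
Proof.
move=> h1 h2; have r0 : 0 <= r by apply: le_trans h1.
have sq (a : R) : `|a| <= r -> a ^+ 2 <= r ^+ 2.
  by move=> ar; rewrite -(real_normK (num_real a)) lerXn2r ?nnegrE.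
rewrite /eucl_dist -[2 * r]ger0_norm ?mulr_ge0// -sqrtr_sqr ler_wsqrtr//.
rewrite exprMn; have := sq _ h1; have := sq _ h2; have := sqr_ge0 r; lra.
Qed.

Lemma le_eucl_dist1 x y : `|x.1 - y.1| <= eucl_dist x y.
Proof. by rewrite -sqrtr_sqr ler_wsqrtr// lerDl sqr_ge0. Qed.

Lemma le_eucl_dist2 x y : `|x.2 - y.2| <= eucl_dist x y.
Proof. by rewrite -sqrtr_sqr ler_wsqrtr// lerDr sqr_ge0. Qed.

Lemma eucl_distxx x : eucl_dist x x = 0.
Proof. by rewrite /eucl_dist !subrr expr0n addr0 sqrtr0. Qed.

Local Open Scope ereal_scope.

Lemma diam_le U r : (forall x y, U x -> U y -> (eucl_dist x y <= r)%R) ->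
  diam U <= r%:E.
Proof.
by move=> H; apply: ge_ereal_sup => _ [x Ux [y Uy <-]]; rewrite lee_fin; exact: H.
Qed.

Lemma le_diam U x y : U x -> U y -> (eucl_dist x y)%:E <= diam U.
Proof. by move=> Ux Uy; apply: ereal_sup_ubound; exists x => //; exists y. Qed.

Lemma diam_ge0 U : U !=set0 -> 0 <= diam U.
Proof. by move=> [x Ux]; apply: le_trans (le_diam Ux Ux); rewrite eucl_distxx. Qed.

Lemma diam_pow_ge0 s U : 0 <= diam_pow s U.
Proof. by rewrite /diam_pow; case: ifP => // _; exact: poweR_ge0. Qed.

Lemma diam_pow_le s U r : (0 <= s)%R -> (0 <= r)%R -> diam U <= r%:E ->
  diam_pow s U <= (r `^ s)%:E.
Proof.
move=> s0 r0 Ur; rewrite /diam_pow; case: eqP => [_|/eqP/set0P U0].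
  by rewrite lee_fin powR_ge0.
rewrite -poweR_EFin; apply: gt0_ler_poweR => //; rewrite in_itv /= leey andbT.
  exact: diam_ge0.
by rewrite lee_fin.
Qed.

Lemma diam_pow_ge s U r : (0 <= s)%R -> (0 <= r)%R -> U !=set0 -> r%:E <= diam U ->
  (r `^ s)%:E <= diam_pow s U.
Proof.
move=> s0 r0 U0 Ur; rewrite /diam_pow; case: eqP => [e|_].
  by move: U0; rewrite e => -[].
rewrite -poweR_EFin; apply: gt0_ler_poweR => //; rewrite in_itv /= leey andbT.
  by rewrite lee_fin.
exact: diam_ge0.
Qed.

Lemma diam_pow_set0 s : diam_pow s (@set0 (R * R)) = 0.
Proof. by rewrite /diam_pow eqxx. Qed.

Lemma eucl_ball_center c r : (0 <= r)%R -> eucl_ball c r c.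
Proof. by rewrite /eucl_ball /= eucl_distxx. Qed.

Lemma le_diam_eucl_ball c r : (0 <= r)%R -> r%:E <= diam (eucl_ball c r).
Proof.
move=> r0; pose y := ((c.1 + r)%R, c.2).
have cy : eucl_dist c y = r.
  rewrite /eucl_dist /= opprD addNKr subrr expr0n addr0 sqrrN sqrtr_sqr.
  by rewrite ger0_norm.
by rewrite -[leLHS](congr1 EFin cy); apply: le_diam;
  [exact: eucl_ball_center | rewrite /eucl_ball /= cy].
Qed.

Lemma diam_eucl_ball_le c r : diam (eucl_ball c r) <= (4 * r)%:E.
Proof.
apply: diam_le => x y cx cy; rewrite (_ : 4 * r = 2 * (2 * r))%R; last by ring.
rewrite /eucl_ball /= in cx cy.
apply: eucl_dist_le.
  have := ler_distD c.1 x.1 y.1; rewrite [`|x.1 - c.1|%R]distrC.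
  have := le_eucl_dist1 c x; have := le_eucl_dist1 c y; lra.
have := ler_distD c.2 x.2 y.2; rewrite [`|x.2 - c.2|%R]distrC.
have := le_eucl_dist2 c x; have := le_eucl_dist2 c y; lra.
Qed.

End PlaneGeometry.

Section CellCode.
Variables (R : realType) (n i : nat).
Hypothesis hi : (0 < i <= n)%N.

Local Notation f := (@peano_coord R n i).
Local Notation W := (@abscissa_prefix R).
Local Notation Y := (@ordinate_prefix R n i).
Local Notation E := (cell_exp n).
Local Notation d := (2 - n%:R^-1 : R).

Let n_gt0 : (0 < n)%N.
Proof. by case/andP: hi; exact: leq_trans. Qed.

Lemma cell_expE k : E k = (k * (2 * n - 1))%N.
Proof.
by rewrite /cell_exp mulnBr muln1 addnBA ?leq_pmull// addnn -mul2n [(n * k)%N]mulnC mulnCA.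
Qed.

Lemma cell_powR k : (3 ^- (n * k)) `^ d = 3 ^- E k :> R.
Proof.
have n0 : n%:R != 0 :> R by rewrite pnatr_eq0 -lt0n.
have p0 : 0 <= 3 ^- k :> R by rewrite invr_ge0 exprn_ge0.
have -> : 3 ^- (n * k) = (3 ^- k) `^ n%:R :> R.
  by rewrite powR_mulrn// exprVn -exprM mulnC.
rewrite -powRrM; have -> : n%:R * d = (2 * n - 1)%:R.
  by rewrite natrB ?natrM ?mulrBr ?divff ?[n%:R * 2]mulrC// muln_gt0 n_gt0//.
by rewrite powR_mulrn// exprVn -exprM cell_expE.
Qed.

(* W determines the first k of the n * k digits of Y, so the remaining ones
   suffice to number the at most 3 ^ E k cells that meet the graph. *)
Definition cell_code k (x : R) : nat :=
  (W (n * k) x * 3 ^ (n * k - k) + Y (n * k) x %% 3 ^ (n * k - k))%N.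

Lemma cell_code_lt k x : (cell_code k x < 3 ^ E k)%N.
Proof.
rewrite /cell_code /cell_exp expnD.
have := digit_prefix_lt (fun m => ternary_rep x m.+1) (n * k).
rewrite -/(W _ x); have : (Y (n * k) x %% 3 ^ (n * k - k) < 3 ^ (n * k - k))%N.
  by rewrite ltn_mod expn_gt0.
nia.
Qed.

(** Division recovers [W], and with it the leading [k] digits of [Y]; the remainder supplies the
    other digits of [Y]. *)
Lemma cell_code_inj k x y : cell_code k x = cell_code k y ->
  W (n * k) x = W (n * k) y /\ Y (n * k) x = Y (n * k) y.
Proof.
rewrite /cell_code; set M := (3 ^ _)%N => e.
have M0 : (0 < M)%N by rewrite expn_gt0.
have eW : W (n * k) x = W (n * k) y.
  have := congr1 (fun z => z %/ M)%N e.
  by rewrite !divnMDl// !(divn_small (ltn_pmod _ M0)) !addn0.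
split=> //.
rewrite eW in e; have {}e := addnI e.
rewrite (divn_eq (Y (n * k) x) M) (divn_eq (Y (n * k) y) M) e.
congr (_ * _ + _)%N.
have kn : (n * k = k + (n * k - k))%N.
  by rewrite subnKC// leq_pmull.
rewrite {1 2}kn /ordinate_prefix !digit_prefix_div; exact: (eq_ordinate_prefix hi).
Qed.

Lemma cell_code_dist k x y : 0 <= x <= 1 -> 0 <= y <= 1 ->
  cell_code k x = cell_code k y ->
  eucl_dist (x, f x) (y, f y) <= 2 * 3 ^- (n * k).
Proof.
move=> x01 y01 /cell_code_inj[eW eY].
by apply: eucl_dist_le; [exact: abscissa_dist|exact: ordinate_dist].
Qed.

End CellCode.

(** * Hausdorff dimension of the graph *)

Section GraphDimension.
Variables (R : realType) (n i : nat).
Hypothesis hi : (0 < i <= n)%N.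

Local Notation f := (@peano_coord R n i).
Local Notation W := (@abscissa_prefix R).
Local Notation Y := (@ordinate_prefix R n i).
Local Notation E := (cell_exp n).
Local Notation d := (2 - n%:R^-1 : R).
Local Notation graph := (graph_on `[0, 1]%classic f).

Let n_gt0 : (0 < n)%N.
Proof. by case/andP: hi; exact: leq_trans. Qed.

Lemma graph_dim_gt0 : 0 < d.
Proof.
rewrite subr_gt0; apply: (@le_lt_trans _ _ 1); last by rewrite ltr1n.
by rewrite invf_le1 ?ler1n ?ltr0n.
Qed.

(** The outer measure of the shadow is the mass given to [U] in the mass distribution principle. *)
Definition shadow (U : set (R * R)) : set R :=
  [set x | 0 <= x <= 1 /\ U (x, f x)].

(** Points at most one cell side apart have indices differing by at most 2 in each coordinate, so 5
    * 5 cells suffice. *)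
Lemma lebesgue_shadow_cells k U : (diam U <= (3 ^- (n * k))%:E)%E ->
  (lebesgue_measure (shadow U) <= (25 * 3 ^- E k)%:E)%E.
Proof.
move=> dU; have [[x0 [x001 Ux0]]|ne] := pselect (exists x, shadow U x); last first.
  have -> : shadow U = set0 by apply/seteqP; split=> // x sx; case: ne; exists x.
  by rewrite measure0 lee_fin mulr_ge0// invr_ge0 ltW// expr3_gt0.
(* The base 5 digits of [e] are the two index offsets, shifted by 2. *)
pose F e := cell n i k (W (n * k) x0 + e %/ 5 - 2) (Y (n * k) x0 + e %% 5 - 2) : set R.
have near_prefix (g : R -> R) (P : R -> nat) x :
    (forall y, 0 <= y <= 1 -> (P y)%:R <= 3 ^+ (n * k) * g y <= (P y)%:R + 1) ->
    0 <= x <= 1 -> `|g x - g x0| <= 3 ^- (n * k) ->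
    (P x0 <= P x + 2 /\ P x + 2 - P x0 < 5)%N.
  move=> gP x01; rewrite -[X in _ <= X -> _]mul1r ler_pdivlMr ?expr3_gt0//.
  rewrite -[X in _ * X]gtr0_norm ?expr3_gt0// -normrM ler_norml mulrBl ![_ * 3 ^+ _]mulrC.
  move=> gx; have := gP _ x01; have := gP _ x001 => g0 g1.
  have h1 : (P x0 <= P x + 2)%N.
    rewrite -(ler_nat R) natrD; lra.
  split=> //; rewrite ltn_subLR// -(ltr_nat R) !natrD.
  lra.
apply: le_trans (_ : \sum_(e < 25) lebesgue_measure (F e) <= _)%E.
  apply: lebesgue_outer_bigcup_ord => x [x01 Ux].
  have dx : eucl_dist (x, f x) (x0, f x0) <= 3 ^- (n * k).
    by rewrite -lee_fin (le_trans _ dU)// le_diam.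
  have [a1 a2] := near_prefix id (W (n * k)) x (@abscissa_itv R (n * k)) x01
    (le_trans (le_eucl_dist1 (x, f x) (x0, f x0)) dx).
  have [b1 b2] := near_prefix f (Y (n * k)) x (fun y _ => ordinate_itv n i (n * k) y) x01
    (le_trans (le_eucl_dist2 (x, f x) (x0, f x0)) dx).
  exists ((W (n * k) x + 2 - W (n * k) x0) * 5 + (Y (n * k) x + 2 - Y (n * k) x0))%N.
    by lia.
  rewrite /F divnMDl// modnMDl (divn_small b2) (modn_small b2) addn0.
  by rewrite !subnKC// !addnK.
apply: (@le_trans _ _ (\sum_(e < 25) (3 ^- E k)%:E)%E).
  by apply: lee_sum => e _; exact: lebesgue_cell.
by rewrite sumEFin sumr_const card_ord lee_fin mulr_natl.
Qed.

(** The second factor is the price of rounding a diameter to the next scale: it is the ratio of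
    [3 ^ cell_exp n k.+1] to [3 ^ cell_exp n k]. *)
Definition mass_constant : R := 25 * 3 ^+ (2 * n - 1).

Lemma mass_constant_gt0 : 0 < mass_constant.
Proof. by rewrite mulr_gt0// expr3_gt0. Qed.

Lemma lebesgue_shadow s U : 0 <= s <= d -> (diam U <= 1)%E ->
  (lebesgue_measure (shadow U) <= mass_constant%:E * diam_pow s U)%E.
Proof.
move=> /andP[s0 sd] U1.
have [->|/set0P U0] := eqVneq U set0.
  rewrite (_ : shadow set0 = set0); last by apply/seteqP; split=> // x [].
  by rewrite measure0 diam_pow_set0 mule0.
have D0 := diam_ge0 U0.
have [D eD] : exists D : R, diam U = D%:E.
  by exists (fine (diam U)); rewrite fineK// ge0_fin_numE// (le_lt_trans U1)// ltry.
rewrite eD !lee_fin in U1 D0.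
(* A set of diameter 0 fits below every scale, so its shadow is null. *)
have [D_gt0|] := ltP 0 D; last first.
  move=> D_le0; apply: le_trans (_ : 0 <= _)%E; last first.
    by rewrite mule_ge0 ?diam_pow_ge0// lee_fin ltW// mass_constant_gt0.
  have small k : (lebesgue_measure (shadow U) <= (25 * 3 ^- E k)%:E)%E.
    by apply: lebesgue_shadow_cells; rewrite eD lee_fin (le_trans D_le0).
  have fin : lebesgue_measure (shadow U) \is a fin_num.
    by rewrite ge0_fin_numE ?measure_ge0// (le_lt_trans (small 0%N))// ltry.
  rewrite -(fineK fin) lee_fin; apply: (@expr3_bounded_le0 _ _ 25) => k.
  rewrite mulrC -ler_pdivlMr ?expr3_gt0// -lee_fin fineK// (le_trans (small k))//.
  rewrite lee_fin ler_pM2l// lef_pV2 ?posrE ?expr3_gt0// ler_weXn2l ?ler1n//.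
  by rewrite (cell_expE hi) leq_pmulr// subn_gt0 (@leq_trans (2 * 1))// leq_mul2l.
have [k0 hk0] : exists k, 3 ^- (n * k) < D.
  have [N /(_ (n * N)%N)] := powR_expr3_lt (@ltr01 R) D_gt0.
  by rewrite leq_pmull// powRr1 ?invr_ge0 ?exprn_ge0// => /(_ isT); exists N.
(* The least such index is positive because [D <= 1]; its predecessor [k] brackets [D] between
   consecutive scales. *)
case: (ex_minnP (ex_intro (fun k => 3 ^- (n * k) < D) k0 hk0)) => -[|k] hk min_k.
  by move: hk; rewrite muln0 invr1 ltNge U1.
have Dk : D <= 3 ^- (n * k).
  by rewrite leNgt; apply/negP => /min_k; rewrite ltnn.
apply: le_trans (@lebesgue_shadow_cells k _ _) _; first by rewrite eD lee_fin.
apply: le_trans (_ : (mass_constant * (3 ^- (n * k.+1)) `^ d)%:E <= _)%E.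
  rewrite (cell_powR R hi) !(cell_expE hi) mulSn exprD lee_fin /mass_constant.
  by rewrite invfM mulrA mulfK ?expf_neq0.
rewrite EFinM lee_pmul2l// ?lte_fin ?mass_constant_gt0//.
apply: le_trans (_ : (D `^ s)%:E <= _)%E; last first.
  by apply: diam_pow_ge; rewrite ?eD.
rewrite lee_fin (le_trans (_ : _ <= D `^ d))//.
  by apply: ge0_ler_powR; rewrite ?nnegrE ?(le_trans s0 sd) ?(ltW hk).
by apply: ger_powR; rewrite // D_gt0.
Qed.

Lemma shadow_cover (U : nat -> set (R * R)) : graph `<=` \bigcup_k U k ->
  `[0, 1]%classic `<=` \bigcup_k shadow (U k).
Proof.
move=> cU x x01; have [k _ Ukx] := cU (x, f x) (ex_intro2 _ _ x x01 erefl).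
by exists k => //; split=> //; move: x01; rewrite /= in_itv.
Qed.

Lemma lebesgue_unit_cover (U : nat -> set (R * R)) : graph `<=` \bigcup_k U k ->
  (1 <= \sum_(0 <= k <oo) lebesgue_measure (shadow (U k)))%E.
Proof.
move=> /shadow_cover/lebesgue_outer_bigcup; apply: le_trans.
by rewrite lebesgue_measure_itv /= lte_fin ltr01 sube0.
Qed.

Lemma hausdorff_measure_graph_gt0 s : 0 <= s <= d ->
  (0 < hausdorff_measure s graph)%E.
Proof.
move=> sd; apply: (@lt_le_trans _ _ (mass_constant^-1)%:E).
  by rewrite lte_fin invr_gt0 mass_constant_gt0.
(* Scale 1 suffices, the measure being a supremum over scales, and it makes [lebesgue_shadow]
   applicable to every set of a cover. *)
apply: le_trans (_ : hausdorff_premeasure s 1 graph <= _)%E; last first.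
  by apply: ereal_sup_ubound; exists 1 => //; exact: ltr01.
apply: le_ereal_inf_tmp => _ [U [cU dU] <-].
rewrite -[leLHS]mule1 lee_pdivrMl ?mass_constant_gt0//.
rewrite -nneseriesZl; last by move=> *; exact: diam_pow_ge0.
apply: le_trans (lebesgue_unit_cover cU) _.
apply: lee_nneseries => [k _ _|k _]; first exact: measure_ge0.
exact: lebesgue_shadow.
Qed.

(** The left side is the sum over all cells of level [k]; the right side shows that it tends to 0
    once [s] exceeds the dimension. *)
Lemma cells_powR k c s : 0 <= c ->
  3 ^+ E k * (c * 3 ^- (n * k)) `^ s = c `^ s * (3 ^- (n * k)) `^ (s - d).
Proof.
move=> c0; have p : 0 < 3 ^- (n * k) :> R by rewrite invr_gt0 expr3_gt0.
rewrite powRM ?(ltW p)// powRB ?(gt_eqF p) ?implybT// (cell_powR R hi) invrK.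
by rewrite mulrCA [3 ^+ _ * _]mulrC.
Qed.

Lemma hausdorff_measure_graph_eq0 s : d < s -> hausdorff_measure s graph = 0%E.
Proof.
move=> ds; have s0 := lt_trans graph_dim_gt0 ds.
apply/eqP; rewrite eq_le; apply/andP; split; last first.
  apply: le_ereal_sup_tmp; exists (hausdorff_premeasure s 1 graph).
    by exists 1 => //; exact: ltr01.
  apply: le_ereal_inf_tmp => _ [U _ <-].
  by apply: nneseries_ge0 => *; exact: diam_pow_ge0.
apply: ge_ereal_sup => _ [delta /= delta0 <-].
apply/lee_addgt0Pr => e e0; rewrite add0e.
have delta2 : 0 < delta / 2 by rewrite divr_gt0.
have c0 : 0 < e / 2 `^ s by rewrite divr_gt0// powR_gt0.
have sd : 0 < s - d by rewrite subr_gt0.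
have [N1 hN1] := powR_expr3_lt (@ltr01 R) delta2.
have [N2 hN2] := powR_expr3_lt sd c0.
pose k := maxn N1 N2.
have knk : (k <= n * k)%N by rewrite leq_pmull.
have := hN1 _ (leq_trans (leq_maxl _ _) knk); have := hN2 _ (leq_trans (leq_maxr _ _) knk).
have rho0 : 0 <= 3 ^- (n * k) :> R by rewrite invr_ge0 exprn_ge0.
rewrite powRr1// => small2 small1 {hN1 hN2}.
pose U e := [set p : R * R | exists x, [/\ 0 <= x <= 1, cell_code n i k x = e & p = (x, f x)]].
have dU j : (diam (U j) <= (2 * 3 ^- (n * k))%:E)%E.
  apply: diam_le => _ _ [x [x01 xj ->]] [y [y01 yj ->]].
  by apply: cell_code_dist => //; rewrite xj.
apply: ge_ereal_inf; exists (\sum_(0 <= j <oo) diam_pow s (U j))%E.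
  exists U => //; split.
    move=> _ [x x01 <-]; exists (cell_code n i k x) => //.
    by exists x; split=> //; move: x01; rewrite /= in_itv.
  by move=> j; apply: le_trans (dU j) _; rewrite lee_fin; lra.
rewrite (@nneseries_split _ _ 0 (3 ^ E k))//; last by move=> *; exact: diam_pow_ge0.
rewrite add0n [X in (_ + X)%E]eseries0 ?adde0; last first.
  move=> j jM _; rewrite (_ : U j = set0) ?diam_pow_set0//.
  apply/seteqP; split=> // p [x [_ xj _]].
  by have := cell_code_lt hi k x; rewrite xj ltnNge jM.
apply: (@le_trans _ _ (\sum_(0 <= j < 3 ^ E k) ((2 * 3 ^- (n * k)) `^ s)%:E)%E).
  by apply: lee_sum => j _; apply: diam_pow_le => //; exact: ltW.
rewrite sumEFin lee_fin sumr_const_nat subn0 -[leLHS]mulr_natl natrX cells_powR//.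
by rewrite mulrC -ler_pdivlMr ?powR_gt0// ltW.
Qed.

End GraphDimension.

(** * Packing dimension of the graph *)

Section PackingLower.
Variables (R : realType) (n i : nat).
Hypothesis hi : (0 < i <= n)%N.

Local Notation f := (@peano_coord R n i).
Local Notation W := (@abscissa_prefix R).
Local Notation Y := (@ordinate_prefix R n i).
Local Notation E := (cell_exp n).
Local Notation d := (2 - n%:R^-1 : R).
Local Notation graph := (graph_on `[0, 1]%classic f).
Local Notation shadow := (@shadow R n i).

Let n_gt0 : (0 < n)%N.
Proof. by case/andP: hi; exact: leq_trans. Qed.

Lemma packing_prepremeasure_ge0 s delta (F : set (R * R)) :
  (0 <= packing_prepremeasure s delta F)%E.
Proof.
apply: ereal_sup_ubound; exists set0, (fun=> (0, 0)), (fun=> 0); split.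
  by split=> //; exact: trivIset_set0.
by rewrite esum_set0.
Qed.

Lemma packing_premeasure_ge0 s (F : set (R * R)) : (0 <= packing_premeasure s F)%E.
Proof. by apply: le_ereal_inf_tmp => _ [delta _ <-]; exact: packing_prepremeasure_ge0. Qed.

(** Numbers at most two sides apart have indices differing by at most 3, hence the modulus 4. *)
Lemma eq_prefix_mod4 (A x y : R) (a b : nat) : a%:R <= A * x <= a%:R + 1 ->
  b%:R <= A * y <= b%:R + 1 -> A * `|x - y| <= 2 -> 0 < A ->
  (a %% 4 = b %% 4)%N -> a = b.
Proof.
move=> ax bx xy A0 ab.
move: xy; rewrite -{1}(gtr0_norm A0) -normrM ler_norml mulrBr => xy.
have h1 : (a <= b + 3)%N by rewrite -(ler_nat R) natrD; lra.
have h2 : (b <= a + 3)%N by rewrite -(ler_nat R) natrD; lra.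
lia.
Qed.

(* The cells of a fixed level are sorted into 16 classes according to the
   residues modulo 4 of their two indices.  Within a class, balls centred in
   distinct cells with the side of a cell as radius are disjoint. *)
Lemma lebesgue_shadow_packing s delta (F : set (R * R)) : 0 <= s <= d -> 0 < delta ->
  (lebesgue_measure (shadow F) <= 16%:E * packing_prepremeasure s delta F)%E.
Proof.
move=> /andP[s0 sd] delta0.
have [k rho_delta] : exists k, 3 ^- (n * k) < delta.
  have [N /(_ (n * N)%N)] := powR_expr3_lt (@ltr01 R) delta0.
  by rewrite leq_pmull// powRr1 ?invr_ge0 ?exprn_ge0// => /(_ isT); exists N.
have rho0 : 0 < 3 ^- (n * k) :> R by rewrite invr_gt0 expr3_gt0.
pose Z c := [set x | shadow F x /\
  (W (n * k) x %% 4 = c %/ 4 /\ Y (n * k) x %% 4 = c %% 4)%N].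
apply: le_trans (_ : \sum_(c < 16) lebesgue_measure (Z c) <= _)%E.
  apply: lebesgue_outer_bigcup_ord => x Fx.
  have l1 : (W (n * k) x %% 4 < 4)%N by rewrite ltn_mod.
  have l2 : (Y (n * k) x %% 4 < 4)%N by rewrite ltn_mod.
  exists (W (n * k) x %% 4 * 4 + Y (n * k) x %% 4)%N; first by lia.
  by split=> //; rewrite divnMDl// modnMDl (divn_small l2) (modn_small l2) addn0.
suff classP c : (lebesgue_measure (Z c) <= packing_prepremeasure s delta F)%E.
  apply: le_trans (_ : \sum_(c < 16) packing_prepremeasure s delta F <= _)%E.
    by apply: lee_sum => c _; exact: classP.
  rewrite -[leRHS](_ : \sum_(c < 16) 1%:E * packing_prepremeasure s delta F = _)%E.
    by apply: lee_sum => c _; rewrite mul1e.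
  by rewrite -ge0_sume_distrl// sumEFin sumr_const card_ord.
(* One ball for each cell meeting the class, centred at a chosen point of the graph in that cell. *)
pose I := [set e | exists2 x, Z c x & cell_code n i k x = e].
pose center e := xget 0 [set x | Z c x /\ cell_code n i k x = e].
have centerP e : I e -> Z c (center e) /\ cell_code n i k (center e) = e.
  by move=> [x Zx xe]; apply: (@xgetPex _ 0 [set x | Z c x /\ _ = e]); exists x.
pose B e : set (R * R) := eucl_ball (center e, f (center e)) (3 ^- (n * k)).
apply: (@le_trans _ _ (\esum_(e in I) diam_pow s (B e))%E); last first.
  apply: ereal_sup_ubound; exists I, (fun e => (center e, f (center e))), (fun=> 3 ^- (n * k)).
  split=> //; split=> [e /centerP[[[_ Fe] _] _]|]; first by rewrite rho0 ltW.
  move=> e1 e2 /centerP[[[x01 _] [a1 b1]] c1] /centerP[[[y01 _] [a2 b2]] c2].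
  move=> [y [/= y1 y2]]; rewrite -c1 -c2 /cell_code.
  have h : `|center e1 - center e2| <= 2 * 3 ^- (n * k) /\
      `|f (center e1) - f (center e2)| <= 2 * 3 ^- (n * k).
    split.
      have := ler_distD y.1 (center e1) (center e2).
      rewrite [`|y.1 - _|]distrC; have := le_eucl_dist1 (center e1, f (center e1)) y.
      have := le_eucl_dist1 (center e2, f (center e2)) y.
      move: y1 y2; rewrite /eucl_ball /=; lra.
    have := ler_distD y.2 (f (center e1)) (f (center e2)).
    rewrite [`|y.2 - _|]distrC; have := le_eucl_dist2 (center e1, f (center e1)) y.
    have := le_eucl_dist2 (center e2, f (center e2)) y.
    move: y1 y2; rewrite /eucl_ball /=; lra.
  move: h; rewrite !ler_pdivlMr ?expr3_gt0// ![_ * 3 ^+ _]mulrC => -[h1 h2].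
  rewrite (eq_prefix_mod4 (abscissa_itv (n * k) x01) (abscissa_itv (n * k) y01) h1)
    ?expr3_gt0 ?a1//.
  by rewrite (eq_prefix_mod4 (ordinate_itv n i (n * k) (center e1))
    (ordinate_itv n i (n * k) (center e2)) h2) ?expr3_gt0 ?b1.
pose G e := [set x | Z c x /\ cell_code n i k x = e].
have ZG : Z c `<=` \bigcup_e G e by move=> x Zx; exists (cell_code n i k x).
apply: le_trans (lebesgue_outer_bigcup ZG) _.
rewrite nneseries_esumT; last by move=> e; exact: measure_ge0.
rewrite [leRHS]esum_mkcond; apply: le_esum => e _.
case: ifPn => [|/negP Ie]; last first.
  rewrite (_ : G e = set0) ?measure0//; apply/seteqP; split=> // x [Zx xe].
  by apply: Ie; rewrite inE; exists x.
rewrite inE => /centerP[[[x01 _] _] ce].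
apply: (@le_trans _ _ (3 ^- E k)%:E).
  apply: (le_trans _ (lebesgue_cell R hi k (W (n * k) (center e)) (Y (n * k) (center e)))).
  apply: le_lebesgue_outer => x [[[? _] _] xe].
  by have [] := cell_code_inj hi (etrans xe (esym ce)).
(* The cell side is at most 1, so lowering the exponent to [s] increases the power; the side is also
   the radius, which bounds the diameter of the ball from below. *)
rewrite -(cell_powR R hi); apply: le_trans (_ : ((3 ^- (n * k)) `^ s)%:E <= _)%E.
  rewrite lee_fin; apply: ger_powR => //; rewrite rho0 invf_le1 ?expr3_gt0//.
  by rewrite exprn_ege1// ler1n.
apply: diam_pow_ge => //.
  by exists (center e, f (center e)); apply: eucl_ball_center; exact: ltW.
by apply: le_diam_eucl_ball; exact: ltW.
Qed.

Lemma packing_measure_graph_gt0 s : 0 <= s <= d -> (0 < packing_measure s graph)%E.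
Proof.
move=> sd; apply: (@lt_le_trans _ _ (16^-1)%:E); first by rewrite lte_fin invr_gt0.
apply: le_ereal_inf_tmp => _ [F cF <-].
rewrite -[leLHS]mule1 lee_pdivrMl//.
rewrite -nneseriesZl; last by move=> *; exact: packing_premeasure_ge0.
apply: le_trans (lebesgue_unit_cover cF) _.
apply: lee_nneseries => [k _ _|k _]; first exact: measure_ge0.
rewrite -lee_pdivrMl//; apply: le_ereal_inf_tmp => _ [delta /= delta0 <-].
by rewrite lee_pdivrMl//; exact: lebesgue_shadow_packing.
Qed.

End PackingLower.

(** * Upper bound for the packing dimension *)

Section PackingUpper.
Variables (R : realType) (n i : nat).
Hypothesis hi : (0 < i <= n)%N.

Local Notation f := (@peano_coord R n i).
Local Notation E := (cell_exp n).
Local Notation d := (2 - n%:R^-1 : R).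
Local Notation graph := (graph_on `[0, 1]%classic f).

Let n_gt0 : (0 < n)%N.
Proof. by case/andP: hi; exact: leq_trans. Qed.

(** The sum is regrouped by level. Applied to the balls of a packing, whose level is the scale of
    the radius. *)
Lemma sum_by_level (X : seq nat) (lev M : nat -> nat) (g : nat -> R) K :
  (forall k, 0 <= g k) -> (forall x, x \in X -> (K <= lev x)%N) ->
  (forall k, (count (fun x => lev x == k) X <= M k)%N) ->
  exists L, \sum_(x <- X) g (lev x) <= \sum_(K <= k < L) (M k)%:R * g k.
Proof.
move=> g0 KX cX; exists (\max_(x <- X) lev x).+1.
rewrite (eq_big_seq (fun x => \sum_(K <= k < (\max_(x <- X) lev x).+1)
    if lev x == k then g k else 0)).
  rewrite exchange_big /=; apply: ler_sum => k _.
  rewrite -big_mkcond /= big_const_seq iter_addr_0 -[leLHS]mulr_natl.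
  by rewrite ler_wpM2r// ler_nat.
move=> x xX.
have lt_lev : (lev x < (\max_(x <- X) lev x).+1)%N by rewrite ltnS leq_bigmax_seq.
rewrite (bigD1_seq (lev x)) ?iota_uniq ?mem_index_iota ?KX//= eqxx.
by rewrite big1 ?addr0// => k; rewrite eq_sym => /negbTE ->.
Qed.

Lemma geometric_sum_le (z : R) K L : 0 <= z -> z < 1 ->
  \sum_(K <= k < L) z ^+ k <= z ^+ K / (1 - z).
Proof.
move=> z0 z1; have z1' : 0 < 1 - z by rewrite subr_gt0.
rewrite ler_pdivlMr//.
have [KL|LK] := leqP K L; last by rewrite big_geq ?mul0r ?exprn_ge0// ltnW.
suff -> : (\sum_(K <= k < L) z ^+ k) * (1 - z) = z ^+ K - z ^+ L.
  by rewrite gerBl exprn_ge0.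
rewrite mulr_suml (telescope_sumr_eq (fun k => - z ^+ k))//.
  by rewrite opprK addrC.
by move=> k _; rewrite mulrBr mulr1 exprSr opprK addrC.
Qed.

(* Centres of balls of the same scale 3 ^- (n * k) have distinct codes at the
   level k + 2, whose cells are smaller than the balls. *)
Lemma packing_scale_count (I : set nat) (c : nat -> R * R) (r : nat -> R) k (X : seq nat) :
  trivIset I (fun j => eucl_ball (c j) (r j)) -> uniq X ->
  (forall j, j \in X -> [/\ I j, graph (c j) & 3 ^- (n * k.+1) < r j]) ->
  (size X <= 3 ^ E k.+2)%N.
Proof.
move=> tI uX hX; pose code j := cell_code n i k.+2 (c j).1.
rewrite -(size_map code) -[leqRHS](size_iota 0); apply: uniq_leq_size.
  rewrite map_inj_in_uniq// => x y xX yX exy.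
  have [Ix [a a01 ca] rx] := hX _ xX; have [Iy [b b01 cb] ry] := hX _ yX.
  apply: tI => //; exists (c y); split; last first.
    by apply: eucl_ball_center; apply: le_trans (ltW ry).
  rewrite /eucl_ball /=; apply: le_trans (ltW rx).
  move: exy; rewrite /code -ca -cb /= => exy.
  apply: le_trans (cell_code_dist hi (k := k.+2) _ _ exy) _.
  - by move: a01; rewrite /= in_itv.
  - by move: b01; rewrite /= in_itv.
  rewrite [(n * k.+2)%N]mulnS exprD invfM mulrA -[leRHS]mul1r ler_pM2r ?invr_gt0 ?expr3_gt0//.
  rewrite ler_pdivrMr ?expr3_gt0// mul1r -natrX ler_nat.
  by rewrite (leq_trans (_ : _ <= 3 ^ 1))%N// leq_pexp2l.
by move=> _ /mapP[x xX ->]; rewrite mem_iota add0n cell_code_lt.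
Qed.

Lemma packing_sum_le s K (I : set nat) (c : nat -> R * R) (r : nat -> R) :
  d < s -> delta_packing (3 ^- (n * K)) graph I c r ->
  (\esum_(j in I) diam_pow s (eucl_ball (c j) (r j)) <=
   (3 ^+ (2 * (2 * n - 1)) * 4 `^ s * ((3 ^- (n * K)) `^ (s - d)
     / (1 - (3 ^- n) `^ (s - d))))%:E)%E.
Proof.
move=> ds [hI tI]; set z := (3 ^- n) `^ (s - d).
have s0 : 0 < s := lt_trans (graph_dim_gt0 R hi) ds.
have sd0 : 0 < s - d by rewrite subr_gt0.
have z_gt0 : 0 < z by rewrite powR_gt0// invr_gt0 expr3_gt0.
have z1 : z < 1.
  rewrite -[ltRHS](congr1 (fun h => h (s - d)) (@powR1 R)); apply: gt0_ltr_powR; rewrite ?nnegrE//.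
  by rewrite invf_lt1 ?expr3_gt0// exprn_egt1// ?ltr1n// -lt0n.
have zE k : (3 ^- (n * k)) `^ (s - d) = z ^+ k.
  rewrite -[RHS]powR_mulrn ?(ltW z_gt0)// /z powRAC powR_mulrn.
    by rewrite exprVn -exprM.
  by rewrite invr_ge0 exprn_ge0.
(* The default is never taken on [I]: radii there are positive and at most [3 ^- (n * K)], so a
   bracketing scale exists. *)
pose lev j := xget 0%N [set k | (K <= k)%N /\ 3 ^- (n * k.+1) < r j <= 3 ^- (n * k)].
have levP j : I j -> (K <= lev j)%N /\ 3 ^- (n * (lev j).+1) < r j <= 3 ^- (n * lev j).
  move=> /hI[_ /andP[r0 rK]].
  apply: (@xgetPex _ 0%N [set k | (K <= k)%N /\ 3 ^- (n * k.+1) < r j <= 3 ^- (n * k)]).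
  have [N /(_ (n * N)%N)] := powR_expr3_lt (@ltr01 R) r0.
  rewrite leq_pmull// powRr1 ?invr_ge0 ?exprn_ge0// => /(_ isT) rN.
  case: (ex_minnP (ex_intro (fun k => 3 ^- (n * k) < r j) N rN)) => -[|k] hk min_k.
    move: hk; rewrite muln0 invr1 => hk; have := lt_le_trans hk rK.
    by rewrite invf_gt1 ?expr3_gt0// ltNge exprn_ege1// ler1n.
  exists k; split; last by rewrite hk /= leNgt; apply/negP => /min_k; rewrite ltnn.
  rewrite leqNgt; apply/negP => kK; have := lt_le_trans hk rK; apply/negP.
  rewrite -leNgt lef_pV2 ?posrE ?expr3_gt0// ler_weXn2l ?ler1n//.
  by rewrite leq_mul2l kK orbT.
pose g k : R := (4 * 3 ^- (n * k)) `^ s.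
apply: ge_ereal_sup => _ [X [finX XI] <-].
rewrite fsbig_finite//=.
set sX := (X in (\sum_(j <- X) _)%R).
have sXI j : j \in sX -> I j by rewrite in_fset_set// inE => /XI.
apply: (@le_trans _ _ (\sum_(j <- sX) (g (lev j))%:E)%E).
  rewrite big_seq [leRHS]big_seq; apply: lee_sum => j /sXI Ij.
  have [_ /andP[_ rj]] := levP _ Ij.
  apply: diam_pow_le; [exact: ltW|by []|].
  by apply: le_trans (diam_eucl_ball_le _ _) _; rewrite lee_fin ler_pM2l.
rewrite sumEFin lee_fin.
have [|j /sXI/levP[]//|k|L] := @sum_by_level sX lev (fun k => 3 ^ E k.+2)%N g K.
- by move=> k; exact: powR_ge0.
- rewrite -size_filter; apply: (@packing_scale_count I c r k) => //.
    by apply: filter_uniq; exact: finmap.fset_uniq.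
  move=> j; rewrite mem_filter => /andP[/eqP levj /sXI Ij].
  by have [gj _] := hI _ Ij; have [_ /andP[rj _]] := levP _ Ij; rewrite -levj.
move=> /le_trans; apply.
rewrite (eq_bigr (fun k => 3 ^+ (2 * (2 * n - 1)) * 4 `^ s * z ^+ k)); last first.
  move=> k _; rewrite natrX (cell_expE hi) -(addn2 k) mulnDl addnC exprD.
  rewrite -(cell_expE hi 2) -(cell_expE hi k).
  by rewrite -[LHS]mulrA /g (cells_powR hi)// zE mulrA.
rewrite -mulr_sumr zE ler_pM2l; first exact: geometric_sum_le (ltW z_gt0) z1.
by rewrite mulr_gt0 ?expr3_gt0// powR_gt0.
Qed.

Lemma packing_measure_graph_eq0 s : d < s -> packing_measure s graph = 0%E.
Proof.
move=> ds; apply/eqP; rewrite eq_le; apply/andP; split; last first.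
  apply: le_ereal_inf_tmp => _ [F _ <-].
  by apply: nneseries_ge0 => *; exact: packing_premeasure_ge0.
(* Since already the premeasure vanishes, the cover by copies of the whole graph is enough. *)
suff pre0 : packing_premeasure s graph = 0%E.
  apply: ereal_inf_lbound; exists (fun=> graph); first by move=> p gp; exists 0%N.
  by apply: eseries0 => *; exact: pre0.
apply/eqP; rewrite eq_le packing_premeasure_ge0 andbT.
apply/lee_addgt0Pr => e e0; rewrite add0e.
have sd0 : 0 < s - d by rewrite subr_gt0.
set A := 3 ^+ (2 * (2 * n - 1)) * 4 `^ s : R.
set z := (3 ^- n) `^ (s - d) : R.
have A0 : 0 < A by rewrite mulr_gt0 ?expr3_gt0// powR_gt0.
have z1 : 0 < 1 - z.
  rewrite subr_gt0 -[ltRHS](congr1 (fun h => h (s - d)) (@powR1 R)).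
  apply: gt0_ltr_powR; rewrite ?nnegrE//.
  by rewrite invf_lt1 ?expr3_gt0// exprn_egt1// ?ltr1n// -lt0n.
(* Chosen so that the bound of [packing_sum_le] becomes at most [e]. *)
have c0 : 0 < e / A * (1 - z) by rewrite mulr_gt0// divr_gt0.
have [K /(_ (n * K)%N)] := powR_expr3_lt sd0 c0.
rewrite leq_pmull// => /(_ isT) small.
apply: ge_ereal_inf; exists (packing_prepremeasure s (3 ^- (n * K)) graph).
  by exists (3 ^- (n * K)) => //=; rewrite invr_gt0 expr3_gt0.
apply: ge_ereal_sup => _ [I [c [r [pack ->]]]].
apply: le_trans (packing_sum_le ds pack) _.
rewrite lee_fin -/A -/z mulrC -ler_pdivlMr// ler_pdivrMr//; exact: ltW.
Qed.

End PackingUpper.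

(** Shared by both dimensions, with [P s] saying that the s-dimensional measure of the graph is 0;
    it fails at [d] itself, where both measures are positive. *)
Lemma ereal_inf_threshold (R : realType) (d : R) (P : R -> Prop) : 0 <= d ->
  (forall s, 0 <= s -> s <= d -> ~ P s) -> (forall s, d < s -> P s) ->
  ereal_inf [set s%:E | s in [set s : R | 0 <= s /\ P s]] = d%:E.
Proof.
move=> d0 lo up; apply/eqP; rewrite eq_le; apply/andP; split.
  apply/lee_addgt0Pr => e e0; apply: ereal_inf_lbound.
  exists (d + e) => //; split; first by rewrite addr_ge0// ltW.
  by apply: up; rewrite ltrDl.
apply: le_ereal_inf_tmp => _ [s [s0 Ps] <-]; rewrite lee_fin leNgt.
by apply/negP => /ltW sd; exact: (lo s).
Qed.

Unset Implicit Arguments.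

Theorem theorem4 (R : realType) (n i : nat) (hn : (2 <= n)%N)
    (hi : (1 <= i <= n)%N) :
  ((forall q : R, n%:R^-1 < q ->
      forall t : R, `[0, 1]%classic t ->
        ~ holder_at `[0, 1]%classic (peano_coord n i) q t) /\
   (forall t : R, `[0, 1]%classic t ->
      ~ differentiable_in `[0, 1]%classic (peano_coord n i) t)) /\
  (hausdorff_dim (graph_on `[0, 1]%classic (@peano_coord R n i))
     = (2 - n%:R^-1)%:E /\
   packing_dim (graph_on `[0, 1]%classic (@peano_coord R n i))
     = (2 - n%:R^-1)%:E).
Proof.
have d0 := ltW (graph_dim_gt0 R hi).
split; split.
- by move=> q nq t; rewrite /= in_itv /=; exact: peano_not_holder.
(* Differentiability would give the exponent 1, which exceeds 1/n because [n] is at least 2. *)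
- move=> t; rewrite /= in_itv /= => t01 /differentiable_holder1.
  by apply: peano_not_holder => //; rewrite invf_lt1 ?ltr1n ?ltr0n// ltnW.
- apply: ereal_inf_threshold => // s; last exact: hausdorff_measure_graph_eq0.
  move=> s0 sd H0; have := @hausdorff_measure_graph_gt0 R n i hi s.
  by rewrite s0 sd H0 ltxx => /(_ isT).
- apply: ereal_inf_threshold => // s; last exact: packing_measure_graph_eq0.
  move=> s0 sd H0; have := @packing_measure_graph_gt0 R n i hi s.
  by rewrite s0 sd H0 ltxx => /(_ isT).
Qed.
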